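(* Let $G$ be a connected graph with $m$ edges. If $p\geq 1$, then $$A_p(G)\geq \left(m+p\,Alb(G)\right)^{\frac{1}{p}}-m^{\frac{1}{p}}.$$ If $0<p<1$, then $$A_p(G)\leq \left(m+p\,Alb(G)\right)^{\frac{1}{p}}-m^{\frac{1}{p}}.$$
   Context: Graphs are finite, simple and undirected; $d(v)$ is the degree of vertex $v$ in $G$. For a positive real number $p$, the general Albertson irregularity index of a connected graph $G$ is $A_p(G)=\left(\sum_{uv\in E(G)}|d(u)-d(v)|^p\right)^{1/p}$. The Albertson irregularity index is $Alb(G)=\sum_{uv\in E(G)}|d(u)-d(v)|$. Here $p$ is a real number. *)

(* Defs.v *)
From HB Require Import structures.
From mathcomp Require Import all_boot all_order all_algebra.
From mathcomp Require Import reals exp.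

Set Implicit Arguments.
Unset Strict Implicit.
Unset Printing Implicit Defensive.

Import Order.TTheory GRing.Theory Num.Theory.
Local Open Scope ring_scope.

Record sgraph := SGraph {
  vertex :> finType;
  adj : rel vertex;
  adj_sym : symmetric adj;
  adj_irrefl : irreflexive adj
}.

(* The graph with no vertices is not counted as connected. *)
Definition connected_graph (G : sgraph) : Prop :=
  (0 < #|G|)%N /\ forall u v : G, connect (@adj G) u v.

Definition degree (G : sgraph) (v : G) : nat := #|[set w | adj v w]|.

(* Edges are unordered pairs, so each edge occurs once in sums and in m. *)
Definition edges (G : sgraph) : {set {set G}} :=
  [set f : {set G} | [exists u, exists v, adj u v && (f == [set u; v])]].

(* |d(u) - d(v)| for the edge f = {u, v}. The choice of the ordered pair (u, v)
   is irrelevant, see imbalanceE; the default value is never used on edges. *)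
Definition imbalance (R : realType) (G : sgraph) (f : {set G}) : R :=
  if [pick e : G * G | f == [set e.1; e.2]] is Some e
  then `|(degree e.1)%:R - (degree e.2)%:R| else 0.

Lemma imbalanceE (R : realType) (G : sgraph) (u v : G) :
  imbalance R [set u; v] = `|(degree u)%:R - (degree v)%:R|.
Proof.
rewrite /imbalance; case: pickP => [[x y] /= /eqP E|/(_ (u, v))]; last first.
  by rewrite /= eqxx.
have : x \in [set u; v] by rewrite E set21.
have : y \in [set u; v] by rewrite E set22.
have : u \in [set x; y] by rewrite -E set21.
have : v \in [set x; y] by rewrite -E set22.
rewrite !in_set2.
by do 4![case/orP=> /eqP ?]; subst=> //; rewrite distrC.
Qed.

Definition Alb (R : realType) (G : sgraph) : R :=
  \sum_(f in edges G) imbalance R f.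

Definition general_Alb (R : realType) (p : R) (G : sgraph) : R :=
  (\sum_(f in edges G) (imbalance R f) `^ p) `^ (1 / p).

(* Main.v *)
(** Write a_e for the imbalance of the edge e.  Bernoulli's inequality compares
    m + p Alb(G) = \sum_e (1 + p a_e) with \sum_e (1 + a_e)^p, and Minkowski's
    inequality, applied to the constant family 1 and the family a, compares the
    (1/p)-th power of the latter with m^(1/p) + A_p(G).  Both inequalities are
    reversed when 0 < p < 1. *)

Require Import Defs.
From HB Require Import structures.
From mathcomp Require Import all_boot all_order all_algebra.
From mathcomp Require Import reals exp.
From mathcomp Require Import classical_sets interval_inference convex hoelder.
From mathcomp Require Import ring lra.

Import Order.TTheory GRing.Theory Num.Theory.
Local Open Scope ring_scope.

Lemma powR_conv_le (R : realType) (p t x y : R) :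
  1 <= p -> 0 <= t -> t <= 1 -> 0 <= x -> 0 <= y ->
  (t * x + (1 - t) * y) `^ p <= t * x `^ p + (1 - t) * y `^ p.
Proof.
move=> p1 t0 t1 x0 y0.
by apply: (convex_powR p1 (Itv01 t0 t1)) => //; rewrite inE /= in_itv/= ?x0 ?y0.
Qed.

Lemma powRVK (R : realType) (p x : R) :
  p != 0 -> 0 <= x -> (x `^ p^-1) `^ p = x.
Proof. by move=> p0 x0; rewrite -powRrM mulVf// powRr1. Qed.

Lemma powRKV (R : realType) (p x : R) :
  p != 0 -> 0 <= x -> (x `^ p) `^ p^-1 = x.
Proof. by move=> p0 x0; rewrite -powRrM mulfV// powRr1. Qed.

(** Concavity comes from convexity of the inverse function: [powR_conv_le] with exponent [p^-1],
    taken at the points [x]^ p[and]y [^ p], is raised to the power [p]. *)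
Lemma powR_conv_ge (R : realType) (p t x y : R) :
  0 < p -> p <= 1 -> 0 <= t -> t <= 1 -> 0 <= x -> 0 <= y ->
  t * x `^ p + (1 - t) * y `^ p <= (t * x + (1 - t) * y) `^ p.
Proof.
move=> p0 p1 t0 t1 x0 y0; have pn0 : p != 0 by rewrite gt_eqF.
have t10 : 0 <= 1 - t by rewrite subr_ge0.
have q1 : 1 <= p^-1 by rewrite invf_ge1.
have := powR_conv_le _ _ _ _ _ q1 t0 t1 (powR_ge0 x p) (powR_ge0 y p).
rewrite !powRKV// => h.
have := ge0_ler_powR (ltW p0) _ _ h; rewrite powRVK//; first apply.
all: by rewrite ?nnegrE ?powR_ge0// addr_ge0// mulr_ge0// powR_ge0.
Qed.

Lemma bernoulli_powR_le (R : realType) (p a : R) :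
  0 < p -> p < 1 -> 0 <= a -> (1 + a) `^ p <= 1 + p * a.
Proof.
move=> p0 p1 a0.
have q0 : 0 < 1 - p by rewrite subr_gt0.
have := @conjugate_powR R ((1 + a) `^ p) 1 p^-1 (1 - p)^-1 (powR_ge0 _ _) ler01.
rewrite !invr_gt0 !invrK => /(_ p0 q0 (subrKC _ _)).
rewrite powRKV ?gt_eqF ?addr_ge0// powR1 mulr1; lra.
Qed.

(** For [1 < p] this is the previous inequality with exponent [p^-1] at the point [p * a], raised to
    the power [p]; the case [p = 1] is an equality. *)
Lemma bernoulli_powR_ge (R : realType) (p a : R) :
  1 <= p -> 0 <= a -> 1 + p * a <= (1 + a) `^ p.
Proof.
rewrite le_eqVlt => /predU1P[<- a0|p1 a0].
  by rewrite mul1r powRr1// addr_ge0.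
have p0 : 0 < p by rewrite (lt_trans ltr01).
have pa0 : 0 <= p * a by rewrite mulr_ge0// ltW.
have := @bernoulli_powR_le R p^-1 (p * a).
rewrite invr_gt0 invf_lt1// mulKf ?gt_eqF// => /(_ p0 p1 pa0) h.
have := ge0_ler_powR (ltW p0) _ _ h; rewrite powRVK ?gt_eqF ?addr_ge0//.
by apply; rewrite nnegrE ?powR_ge0// addr_ge0.
Qed.

Section Minkowski.
Variables (R : realType) (I : finType) (P : pred I) (p : R).
Implicit Types (x y : I -> R) (a b : R).
Hypothesis p0 : 0 < p.

Let pn0 : p != 0. Proof. by rewrite gt_eqF. Qed.

Lemma sum_powR_ge0 x : 0 <= \sum_(i | P i) x i `^ p.
Proof. by apply: sumr_ge0 => i _; exact: powR_ge0. Qed.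

Lemma sum_powR_normalized a x : 0 < a -> (forall i, P i -> 0 <= x i) ->
  \sum_(i | P i) x i `^ p = a `^ p -> \sum_(i | P i) (x i / a) `^ p = 1.
Proof.
move=> a0 x0 xa; have ai0 : 0 <= a^-1 by rewrite invr_ge0 ltW.
have -> : \sum_(i | P i) (x i / a) `^ p = \sum_(i | P i) x i `^ p * a^-1 `^ p.
  by apply: eq_bigr => i Pi; rewrite powRM ?x0.
by rewrite -mulr_suml xa -powRM ?(ltW a0)// divff ?gt_eqF// powR1.
Qed.

(* [x + y] is a convex combination of the normalized families [x / a] and
   [y / b], dilated by [a + b]. *)
Lemma powR_dilation a b u v : 0 < a -> 0 < b -> 0 <= u -> 0 <= v ->
  (u + v) `^ p = (a + b) `^ p *
    (a / (a + b) * (u / a) + (1 - a / (a + b)) * (v / b)) `^ p.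
Proof.
move=> a0 b0 u0 v0; have ab0 : 0 < a + b by rewrite addr_gt0.
have -> : a / (a + b) * (u / a) + (1 - a / (a + b)) * (v / b) =
          (u + v) / (a + b).
  by field; rewrite !gt_eqF.
rewrite -powRM ?(ltW ab0)//; last by rewrite divr_ge0 ?addr_ge0// ltW.
by rewrite mulrCA divff ?gt_eqF// mulr1.
Qed.

Lemma weight_itv a b : 0 < a -> 0 < b -> 0 <= a / (a + b) /\ a / (a + b) <= 1.
Proof.
move=> a0 b0; have ab0 : 0 < a + b by rewrite addr_gt0.
split; first by rewrite divr_ge0 ?ltW.
by rewrite ler_pdivrMr// mul1r lerDl ltW.
Qed.

Lemma sum_powR_split a b x y : 0 < a -> 0 < b ->
  (forall i, P i -> 0 <= x i) -> (forall i, P i -> 0 <= y i) ->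
  \sum_(i | P i) x i `^ p = a `^ p -> \sum_(i | P i) y i `^ p = b `^ p ->
  (a + b) `^ p = \sum_(i | P i) (a + b) `^ p *
    (a / (a + b) * (x i / a) `^ p + (1 - a / (a + b)) * (y i / b) `^ p).
Proof.
move=> a0 b0 x0 y0 xa yb; rewrite -mulr_sumr big_split/= -!mulr_sumr.
by rewrite !sum_powR_normalized// !mulr1 subrKC mulr1.
Qed.

(** After [powR_dilation], each term is bounded by convexity of the power function. *)
Lemma sum_powRD_le a b x y : 1 <= p -> 0 < a -> 0 < b ->
  (forall i, P i -> 0 <= x i) -> (forall i, P i -> 0 <= y i) ->
  \sum_(i | P i) x i `^ p = a `^ p -> \sum_(i | P i) y i `^ p = b `^ p ->
  \sum_(i | P i) (x i + y i) `^ p <= (a + b) `^ p.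
Proof.
move=> p1 a0 b0 x0 y0 xa yb.
rewrite (sum_powR_split _ _ _ _ a0 b0 x0 y0 xa yb); apply: ler_sum => i Pi.
have [t0 t1] := weight_itv _ _ a0 b0.
rewrite (powR_dilation _ _ _ _ a0 b0 (x0 i Pi) (y0 i Pi)) ler_wpM2l ?powR_ge0//.
by rewrite powR_conv_le// divr_ge0 ?x0 ?y0// ltW.
Qed.

(** Same decomposition, with concavity in place of convexity. *)
Lemma sum_powRD_ge a b x y : p <= 1 -> 0 < a -> 0 < b ->
  (forall i, P i -> 0 <= x i) -> (forall i, P i -> 0 <= y i) ->
  \sum_(i | P i) x i `^ p = a `^ p -> \sum_(i | P i) y i `^ p = b `^ p ->
  (a + b) `^ p <= \sum_(i | P i) (x i + y i) `^ p.
Proof.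
move=> p1 a0 b0 x0 y0 xa yb.
rewrite (sum_powR_split _ _ _ _ a0 b0 x0 y0 xa yb); apply: ler_sum => i Pi.
have [t0 t1] := weight_itv _ _ a0 b0.
rewrite (powR_dilation _ _ _ _ a0 b0 (x0 i Pi) (y0 i Pi)) ler_wpM2l ?powR_ge0//.
by rewrite powR_conv_ge// divr_ge0 ?x0 ?y0// ltW.
Qed.

Lemma sum_powR_eq0 x : \sum_(i | P i) x i `^ p = 0 -> forall i, P i -> x i = 0.
Proof.
move=> /eqP; rewrite psumr_eq0; last by move=> i _; exact: powR_ge0.
move=> /allP h i Pi; have := h i (mem_index_enum i).
by rewrite Pi/= => /eqP /powR_eq0_eq0.
Qed.

(** Names the p-norm [a] of the family, by which the normalization divides. *)
Lemma sum_powR_root x : exists a, [/\ 0 <= a,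
  \sum_(i | P i) x i `^ p = a `^ p & (\sum_(i | P i) x i `^ p) `^ p^-1 = a].
Proof.
exists ((\sum_(i | P i) x i `^ p) `^ p^-1).
by rewrite powR_ge0 powRVK// sum_powR_ge0.
Qed.

(** The degenerate case, where normalizing would divide by zero: a family of norm 0 vanishes on [P],
    so adding it changes nothing. *)
Lemma sum_powRD_eq0 a b x y : a = 0 \/ b = 0 ->
  \sum_(i | P i) x i `^ p = a `^ p -> \sum_(i | P i) y i `^ p = b `^ p ->
  \sum_(i | P i) (x i + y i) `^ p = (a + b) `^ p.
Proof.
move=> [->|->] xa yb.
- rewrite powR0// in xa; rewrite add0r -yb.
  by apply: eq_bigr => i Pi; rewrite (sum_powR_eq0 _ xa _ Pi) add0r.
- rewrite powR0// in yb; rewrite addr0 -xa.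
  by apply: eq_bigr => i Pi; rewrite (sum_powR_eq0 _ yb _ Pi) addr0.
Qed.

Lemma minkowski_sum x y : 1 <= p ->
  (forall i, P i -> 0 <= x i) -> (forall i, P i -> 0 <= y i) ->
  (\sum_(i | P i) (x i + y i) `^ p) `^ p^-1 <=
  (\sum_(i | P i) x i `^ p) `^ p^-1 + (\sum_(i | P i) y i `^ p) `^ p^-1.
Proof.
move=> p1 x0 y0.
have [a [a0 xa ->]] := sum_powR_root x; have [b [b0 yb ->]] := sum_powR_root y.
have ab0 : 0 <= a + b by rewrite addr_ge0.
have h : \sum_(i | P i) (x i + y i) `^ p <= (a + b) `^ p.
  move: a0 b0; rewrite !le0r => /predU1P[a0|a0]; last move=> /predU1P[b0|b0].
  - by rewrite (sum_powRD_eq0 _ _ _ _ _ xa yb)//; left.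
  - by rewrite (sum_powRD_eq0 _ _ _ _ _ xa yb)//; right.
  - exact: sum_powRD_le.
(* Writing [a + b] as the root of its own p-th power leaves only monotonicity of the root, applied
   to [h]. *)
rewrite -[leRHS](powRKV _ _ _ pn0 ab0).
by apply: ge0_ler_powR h;
  rewrite ?invr_ge0 ?(ltW p0) ?nnegrE ?sum_powR_ge0 ?powR_ge0.
Qed.

Lemma reverse_minkowski_sum x y : p <= 1 ->
  (forall i, P i -> 0 <= x i) -> (forall i, P i -> 0 <= y i) ->
  (\sum_(i | P i) x i `^ p) `^ p^-1 + (\sum_(i | P i) y i `^ p) `^ p^-1 <=
  (\sum_(i | P i) (x i + y i) `^ p) `^ p^-1.
Proof.
move=> p1 x0 y0.
have [a [a0 xa ->]] := sum_powR_root x; have [b [b0 yb ->]] := sum_powR_root y.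
have ab0 : 0 <= a + b by rewrite addr_ge0.
have h : (a + b) `^ p <= \sum_(i | P i) (x i + y i) `^ p.
  move: a0 b0; rewrite !le0r => /predU1P[a0|a0]; last move=> /predU1P[b0|b0].
  - by rewrite (sum_powRD_eq0 _ _ _ _ _ xa yb)//; left.
  - by rewrite (sum_powRD_eq0 _ _ _ _ _ xa yb)//; right.
  - exact: sum_powRD_ge.
rewrite -[leLHS](powRKV _ _ _ pn0 ab0).
by apply: ge0_ler_powR h;
  rewrite ?invr_ge0 ?(ltW p0) ?nnegrE ?sum_powR_ge0 ?powR_ge0.
Qed.

End Minkowski.

Lemma imbalance_ge0 (R : realType) (G : sgraph) (f : {set G}) :
  0 <= imbalance R f.
Proof. by rewrite /imbalance; case: pickP. Qed.

Theorem theorem3p5 (R : realType) (G : sgraph) (m : nat) (p : R)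
  (hG : connected_graph G) (hm : #|edges G| = m) :
  (1 <= p ->
     (m%:R + p * Alb R G) `^ (1 / p) - m%:R `^ (1 / p) <= general_Alb p G) /\
  (0 < p < 1 ->
     general_Alb p G <= (m%:R + p * Alb R G) `^ (1 / p) - m%:R `^ (1 / p)).
Proof.
(* In this form the [p^-1]-th power of [m%:R] is the p-norm of the constant family 1, as Minkowski
   requires. *)
have mE : m%:R = \sum_(f in edges G) (1 : R) `^ p.
  by rewrite powR1 sumr_const hm.
have mAlbE : m%:R + p * Alb R G = \sum_(f in edges G) (1 + p * imbalance R f).
  by rewrite big_split/= sumr_const hm -mulr_sumr.
have a0 f : f \in edges G -> 0 <= imbalance R f by rewrite imbalance_ge0.
rewrite /general_Alb !div1r; split=> [p1|/andP[p0 p1]].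
  have p0 : 0 < p by rewrite (lt_le_trans ltr01).
  have bern : m%:R + p * Alb R G <=
      \sum_(f in edges G) (1 + imbalance R f) `^ p.
    by rewrite mAlbE; apply: ler_sum => f /a0; exact: bernoulli_powR_ge.
  (* Only the isolated [m%:R] on the right becomes a sum; the one next to [p * Alb R G] is handled
     by [bern]. *)
  rewrite lerBlDl [X in _ <= X `^ _ + _]mE.
  apply: le_trans (minkowski_sum _ _ _ _ p0 _ _ p1 _ a0) => //.
  apply: ge0_ler_powR bern; rewrite ?nnegrE ?invr_ge0 ?(ltW p0)//.
    rewrite mAlbE sumr_ge0// => f /a0 ?.
    by rewrite addr_ge0// mulr_ge0// ltW.
  exact: sum_powR_ge0.
have bern : \sum_(f in edges G) (1 + imbalance R f) `^ p <= m%:R + p * Alb R G.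
  by rewrite mAlbE; apply: ler_sum => f /a0; exact: bernoulli_powR_le.
rewrite lerBrDl [X in X `^ _ + _ <= _]mE.
apply: le_trans (reverse_minkowski_sum _ _ _ _ p0 _ _ (ltW p1) _ a0) _ => //.
(* Monotonicity of the root needs both sides of [bern] to be nonnegative; the larger side inherits
   this from the smaller. *)
have S0 := sum_powR_ge0 _ _ (mem (edges G)) p (fun f => 1 + imbalance R f).
by apply: (ge0_ler_powR _ _ _ bern);
  rewrite ?nnegrE ?invr_ge0 ?(ltW p0)// (le_trans S0).
Qed.
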